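(* The symmetries of the average normalized log-likelihood ratio $\langle\mathcal{L}\rangle$ of the stochastic block model are also symmetries of its $\eta$-detectability. That is, let $I=\{(r,s):1\le r\le s\le q\}$, let $\pi$ be a permutation of $I$ and let $\gamma\in\{0,1\}$. Then the transformation $(\bm{\alpha},\bm{P})\mapsto(\bm{\alpha}',\bm{P}')$ given by $$\alpha_{rs}'=\alpha_{\pi(r,s)},\qquad p_{rs}'=\gamma+(1-2\gamma)\,p_{\pi(r,s)}\qquad((r,s)\in I),$$ with $m^{\max}$ held fixed, which preserves $\langle\mathcal{L}\rangle$, also preserves $\eta$: $$\eta(\bm{\alpha}',\bm{P}')=\eta(\bm{\alpha},\bm{P}).$$
   Context: In the stochastic block model (SBM), $n$ nodes are partitioned into $q$ blocks of sizes $n_1,\dots,n_q$, and each pair of distinct nodes, one in block $r$ and one in block $s$, is joined by an undirected edge independently with probability $p_{rs}=p_{sr}\in[0,1]$; $\bm{P}=(p_{rs})_{(r,s)\in I}$. The number of possible edges between blocks $r$ and $s$ is $m_{rs}^{\max}=\binom{n_r}{2}$ if $r=s$ and $n_rn_s$ otherwise; $m^{\max}=\sum_{(r,s)\in I}m_{rs}^{\max}$, $\alpha_{rs}=m_{rs}^{\max}/m^{\max}$ and $\bm{\alpha}=(\alpha_{rs})_{(r,s)\in I}$, so $\sum_{(r,s)\in I}\alpha_{rs}=1$. The average density is $\rho=\sum_{(r,s)\in I}\alpha_{rs}p_{rs}$. $\mathcal{L}$ is $1/m^{\max}$ times the logarithm of the ratio of the likelihood of a network under the SBM (with the planted partition and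 $\bm{P}$) to its likelihood under the Erdős–Rényi model in which every edge has probability $\rho$. For a network drawn from the SBM, $\mathcal{L}$ is the random variable $$\mathcal{L}=\frac{1}{m^{\max}}\sum_{(r,s)\in I}\left\{m_{rs}\log\frac{p_{rs}}{\rho}+(m_{rs}^{\max}-m_{rs})\log\frac{1-p_{rs}}{1-\rho}\right\},$$ where the $m_{rs}$ (numbers of edges between blocks $r$ and $s$) are independent binomial variables, $m_{rs}\sim\mathrm{Bin}(m_{rs}^{\max},p_{rs})$ with $m_{rs}^{\max}=\alpha_{rs}m^{\max}$; terms with zero coefficient are taken to be $0$. Thus the law of $\mathcal{L}$ is determined by $(\bm{\alpha},\bm{P},m^{\max})$, and this description defines it for the transformed parameters as well. Its mean is $$\langle\mathcal{L}(\bm{\alpha},\bm{P})\rangle=h(\rho)-\sum_{(r,s)\in I}\alpha_{rs}h(p_{rs}),\qquad h(p)=-p\log p-(1-p)\log(1-p).$$ The ensemble is called $\eta$-detectable, with $\eta=\eta(\bm{\alpha},\bm{P})$ (at fixed $m^{\max}$), if $$\Pr(\mathcal{L}<0)=1-\eta .$$ The symmetries of $\langle\mathcal{L}\rangle$ are the invertible, space-preserving transformations of the parameter space of $(\bm{\alpha},\bm{P})$, valid at every point, that preserve $\langle\mathcal{L}(\bm{\alpha},\bm{P})\rangle$; they are the transformations of the form displayed in the claim. *)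

(* Defs.v *)
From HB Require Import structures.
From mathcomp Require Import all_boot all_order all_algebra perm.
From mathcomp Require Import ring lra.
From mathcomp Require Import all_classical all_reals all_analysis.

Set Implicit Arguments.
Unset Strict Implicit.
Unset Printing Implicit Defensive.

Import Order.TTheory GRing.Theory Num.Theory.
Import numFieldNormedType.Exports.

Local Open Scope classical_set_scope.
Local Open Scope ring_scope.

(* The index set I of unordered pairs of blocks, with blocks numbered from 0. *)
Definition blockPair (q : nat) : Type := {rs : 'I_q * 'I_q | (rs.1 <= rs.2)%N}.
HB.instance Definition _ (q : nat) := Finite.on (blockPair q).

(* The parameter space of (alpha, P) at fixed mmax. The fractions alpha are only
   required to make every mmax * alpha i an admissible number of binomial trials,
   not to come from block sizes: the latter would not be stable under permutations
   of I. Ensembles given by block sizes are the points sbm_of_blocks below. *)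
Record sbm_param (R : realType) (q mmax : nat) := SBMParam {
  alpha : blockPair q -> R;
  prob : blockPair q -> R;
  mmax_gt0 : (0 < mmax)%N;
  alpha_ge0 : forall i, 0 <= alpha i;
  alpha_sum1 : \sum_i alpha i = 1;
  alpha_nat : forall i, alpha i * mmax%:R \is a Num.nat;
  prob_itv : forall i, 0 <= prob i <= 1 }.

Definition max_edges (q : nat) (n : 'I_q -> nat) (i : blockPair q) : nat :=
  let: (r, s) := val i in if r == s then 'C(n r, 2) else (n r * n s)%N.

Program Definition sbm_of_blocks (R : realType) (q : nat) (n : 'I_q -> nat)
    (p : blockPair q -> R) (p01 : forall i, 0 <= p i <= 1)
    (n0 : (0 < \sum_i max_edges n i)%N) :
    sbm_param R q (\sum_i max_edges n i) :=
  @SBMParam R q _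
    (fun i => (max_edges n i)%:R / (\sum_j max_edges n j)%:R) p n0 _ _ _ p01.
Next Obligation. by move=> R q n p p01 n0 i; rewrite divr_ge0. Qed.
Next Obligation.
move=> R q n p p01 n0; rewrite -mulr_suml -natr_sum divff//.
by rewrite pnatr_eq0 -lt0n.
Qed.
Next Obligation.
move=> R q n p p01 n0 i; rewrite divfK ?natr_nat//.
by rewrite pnatr_eq0 -lt0n.
Qed.

Definition edgeCounts (q mmax : nat) : Type :=
  {ffun blockPair q -> 'I_mmax.+1}.
HB.instance Definition _ (q mmax : nat) := Finite.on (edgeCounts q mmax).
HB.instance Definition _ (q mmax : nat) :=
  isPointed.Build (edgeCounts q mmax) [ffun=> ord0].
HB.instance Definition _ (q mmax : nat) :=
  @isMeasurable.Build default_measure_display (edgeCounts q mmax)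
    discrete_measurable discrete_measurable0
    discrete_measurableC discrete_measurableU.

Section ensemble.
Context {R : realType} {q mmax : nat}.
Implicit Type theta : sbm_param R q mmax.

Definition trials theta i : nat := Num.truncn (alpha theta i * mmax%:R).

Lemma trialsE theta i : (trials theta i)%:R = alpha theta i * mmax%:R.
Proof. by rewrite truncnK// alpha_nat. Qed.

Lemma trials_le theta i : (trials theta i <= mmax)%N.
Proof.
rewrite -(ler_nat R) trialsE ler_piMl// -(alpha_sum1 theta) (bigD1 i)//=.
by rewrite lerDl sumr_ge0// => j _; exact: alpha_ge0.
Qed.

Definition density theta : R := \sum_i alpha theta i * prob theta i.

(* Total convention: ln x = 0 for x <= 0 and x / 0 = 0. A logarithm whose argument
   is 0 or has a zero denominator thus only ever counts when its coefficient is 0,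
   up to edge counts k of probability 0. *)
Definition llr theta (k : edgeCounts q mmax) : R :=
  mmax%:R^-1 * \sum_i
    ((k i)%:R * ln (prob theta i / density theta)
     + ((trials theta i)%:R - (k i)%:R)
       * ln ((1 - prob theta i) / (1 - density theta))).

(* Joint law of the edge counts k i, independent with law Bin(trials i, prob i):
   edge_counts_prob_rect gives this on all products of events. *)
Definition edge_counts_pmf theta (k : edgeCounts q mmax) : R :=
  \prod_i binomial_pmf (trials theta i) (prob theta i) (k i).

Definition edge_counts_prob theta (A : set (edgeCounts q mmax)) : \bar R :=
  \esum_(k in A) (edge_counts_pmf theta k)%:E.

Lemma edge_counts_pmf_ge0 theta (k : edgeCounts q mmax) :
  0 <= edge_counts_pmf theta k.
Proof. by apply: prodr_ge0 => i _; apply/binomial_pmf_ge0/prob_itv. Qed.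

Lemma edge_counts_probE theta A : edge_counts_prob theta A =
  (\sum_(k : edgeCounts q mmax | k \in A) edge_counts_pmf theta k)%:E.
Proof.
have finT : finite_set [set: edgeCounts q mmax] by exact: finite_finset.
rewrite /edge_counts_prob esum_mkcond (esum_fset finT); last first.
  by move=> k _; case: ifP => // _; rewrite lee_fin edge_counts_pmf_ge0.
rewrite (fsbigE (index_enum (edgeCounts q mmax)))//.
- rewrite -sumEFin [RHS]big_mkcond/= big_mkcond/=; apply: eq_bigr => k _.
  by rewrite in_setT.
- exact: index_enum_uniq.
- by move=> k _; rewrite mem_index_enum.
Qed.

Lemma sum_binomial theta i (f : nat -> R) :
  \sum_(j < mmax.+1) binomial_pmf (trials theta i) (prob theta i) j * f j =
  \sum_(j < (trials theta i).+1)
    binomial_pmf (trials theta i) (prob theta i) j * f j.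
Proof.
have le : ((trials theta i).+1 <= mmax.+1)%N by rewrite ltnS trials_le.
rewrite (big_ord_widen _ (fun j => binomial_pmf _ _ j * f j) le).
rewrite [RHS]big_mkcond/=; apply: eq_bigr => j _; case: ifPn => //.
by rewrite -leqNgt => tj; rewrite /binomial_pmf bin_small// mulr0n mul0r.
Qed.

Lemma sum_binomial1 theta i :
  \sum_(j < mmax.+1) binomial_pmf (trials theta i) (prob theta i) j = 1.
Proof.
under eq_bigr do rewrite -[binomial_pmf _ _ _]mulr1.
rewrite (sum_binomial theta i (fun=> 1)) /binomial_pmf.
under eq_bigr do rewrite mulr1 mulrC.
rewrite -exprDn_comm; last exact: mulrC.
by rewrite addrC unstable.add_onemK expr1n.
Qed.

Lemma sum_edge_counts_pmf theta (f : blockPair q -> nat -> R) :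
  \sum_(k : edgeCounts q mmax) edge_counts_pmf theta k * \prod_i f i (k i) =
  \prod_i \sum_(j < mmax.+1)
    binomial_pmf (trials theta i) (prob theta i) j * f i j.
Proof.
by rewrite bigA_distr_bigA; apply: eq_bigr => k _; rewrite big_split.
Qed.

Let edge_counts_prob0 theta : edge_counts_prob theta set0 = 0%E.
Proof. by rewrite /edge_counts_prob esum_set0. Qed.

Let edge_counts_prob_ge0 theta A : (0 <= edge_counts_prob theta A)%E.
Proof. by apply: esum_ge0 => k _; rewrite lee_fin edge_counts_pmf_ge0. Qed.

Let edge_counts_prob_sigma_additive theta :
  semi_sigma_additive (edge_counts_prob theta).
Proof.
move=> F mF tF mUF; apply: cvg_toP.
  apply: ereal_nondecreasing_is_cvgn => a b ab.
  apply: lee_sum_nneg_natr => // n _ _; exact: edge_counts_prob_ge0.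
rewrite /edge_counts_prob nneseries_sum_bigcup// => k.
by rewrite lee_fin edge_counts_pmf_ge0.
Qed.

HB.instance Definition _ theta := isMeasure.Build _ _ _ (edge_counts_prob theta)
  (edge_counts_prob0 theta) (edge_counts_prob_ge0 theta)
  (@edge_counts_prob_sigma_additive theta).

Let edge_counts_probT theta : edge_counts_prob theta [set: _] = 1%E.
Proof.
rewrite edge_counts_probE; congr _%:E; rewrite (eq_bigl predT); last first.
  by move=> k; rewrite in_setT.
transitivity (\sum_(k : edgeCounts q mmax)
    edge_counts_pmf theta k * \prod_(i : blockPair q) 1).
  by apply: eq_bigr => k _; rewrite big1// mulr1.
rewrite (sum_edge_counts_pmf theta (fun _ _ => 1)); apply: big1 => i _.
under eq_bigr do rewrite mulr1.
exact: sum_binomial1.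
Qed.

HB.instance Definition _ theta := @Measure_isProbability.Build _ _ R
  (edge_counts_prob theta) (edge_counts_probT theta).

Lemma edge_counts_prob_rect theta (A : blockPair q -> set nat) :
  edge_counts_prob theta
    [set k : edgeCounts q mmax | forall i, A i (k i)] =
  (\prod_i fine (binomial_prob (trials theta i) (prob theta i) (A i)))%:E.
Proof.
rewrite edge_counts_probE; congr _%:E; pose f i j : R := (j \in A i)%:R.
transitivity (\sum_k edge_counts_pmf theta k * \prod_i f i (k i)).
  rewrite big_mkcond/=; apply: eq_bigr => k _.
  case: ifPn => [/set_mem/= kA|/negP kA].
    by rewrite big1 ?mulr1// /f => i _; rewrite mem_set.
  have [i iA] : exists i, (k i : nat) \notin A i.
    apply: contra_notP kA => /forallNP kA; apply/mem_set => i /=.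
    by apply/set_mem/negPn/negP/kA.
  by rewrite (bigD1 i)//= /f (negbTE iA) mul0r mulr0.
rewrite sum_edge_counts_pmf; apply: eq_bigr => i _.
rewrite sum_binomial /binomial_prob prob_itv.
set n := trials theta i; set p := prob theta i.
have pmf0 j : (0 <= (binomial_pmf n p j)%:E)%E.
  by rewrite lee_fin binomial_pmf_ge0// prob_itv.
rewrite esum_mkcond (esumID `I_n.+1)//=; last by move=> j _; case: ifP.
rewrite [X in (_ + X)%E]esum1 ?adde0; last first.
  move=> j [_ /negP]; rewrite -leqNgt => nj; case: ifP => // _.
  by rewrite /binomial_pmf bin_small.
rewrite setTI esum_fset//; last by move=> j _; case: ifP.
rewrite -fsbig_ord/=.
transitivity (fine (\sum_(j < n.+1) (binomial_pmf n p j * f i j)%:E)).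
  by rewrite sumEFin.
congr fine; apply: eq_bigr => j _; rewrite /f.
by case: ifP => _; rewrite ?mulr1 ?mulr0.
Qed.

Lemma edge_counts_expectationE theta (X : edgeCounts q mmax -> R) :
  ('E_(edge_counts_prob theta)[X] =
   (\sum_k edge_counts_pmf theta k * X k)%:E)%E.
Proof.
set P := edge_counts_prob theta.
have XE k : (X k)%:E = (\sum_j ((X j)%:E * (\1_[set j] k)%:E))%E.
  rewrite (bigD1 k)//= big1 ?adde0.
    by rewrite indicE mem_set// mule1.
  move=> j jk; rewrite indicE (_ : _ \in _ = false) ?mule0//.
  by apply/negbTE/negP => /set_mem/= kj; rewrite kj eqxx in jk.
have iI (j : edgeCounts q mmax) :
    P.-integrable [set: _] (fun k => (\1_[set j] k)%:E).
  exact: integrable_indic.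
rewrite unlock; under eq_integral do rewrite XE.
rewrite integral_sum//; last by move=> j; exact: integrableZl.
rewrite -sumEFin; apply: eq_bigr => j _.
rewrite integralZl// integral_indic// setIT muleC EFinM; congr (_ * _)%E.
by rewrite /= /edge_counts_prob esum_set1// lee_fin edge_counts_pmf_ge0.
Qed.

Lemma sum_binomial_mean theta i :
  \sum_(j < mmax.+1) binomial_pmf (trials theta i) (prob theta i) j * j%:R
  = (trials theta i)%:R * prob theta i.
Proof.
rewrite sum_binomial; set n := trials theta i; set p := prob theta i.
rewrite big_ord_recl mulr0 add0r.
case: n => [|n]; first by rewrite big_ord0 mul0r.
transitivity (n.+1%:R * p *
    \sum_(j < n.+1) p ^+ j * unstable.onem p ^+ (n - j) *+ 'C(n, j)).
  rewrite mulr_sumr; apply: eq_bigr => j _.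
  have binE : j.+1%:R * 'C(n.+1, j.+1)%:R = n.+1%:R * 'C(n, j)%:R :> R.
    by rewrite -!natrM -mul_bin_diag.
  rewrite /binomial_pmf lift0 subSS exprS -mulrA.
  move: (p ^+ j * _) => x.
  rewrite -[_ *+ 'C(n.+1, _)]mulr_natr -[_ *+ 'C(n, j)]mulr_natr.
  rewrite -mulrA ['C(_, _)%:R * _]mulrC binE.
  by rewrite mulrACA; congr (_ * _); exact: mulrC.
under eq_bigr do rewrite mulrC.
rewrite -exprDn_comm; last exact: mulrC.
by rewrite addrC unstable.add_onemK expr1n mulr1.
Qed.

Lemma sum_marginal theta i (f : nat -> R) :
  \sum_k edge_counts_pmf theta k * f (k i) =
  \sum_(j < mmax.+1) binomial_pmf (trials theta i) (prob theta i) j * f j.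
Proof.
pose g i' j := if i' == i then f j else 1.
transitivity (\sum_k edge_counts_pmf theta k * \prod_i g i (k i)).
  apply: eq_bigr => k _; rewrite (bigD1 i)//= big1 ?mulr1 /g ?eqxx//.
  by move=> i' /negbTE ->.
rewrite sum_edge_counts_pmf (bigD1 i)//= [X in _ * X]big1 ?mulr1.
  by rewrite /g eqxx.
move=> i' /negbTE ii'; rewrite /g ii'.
by under eq_bigr do rewrite mulr1; exact: sum_binomial1.
Qed.

Definition mean_llr theta : R := fine ('E_(edge_counts_prob theta)[llr theta]).

Definition eta theta : R :=
  1 - fine (edge_counts_prob theta [set k | llr theta k < 0]).

Definition bin_entropy (p : R) : R := - p * ln p - (1 - p) * ln (1 - p).

Lemma mean_llrE theta : mean_llr theta =
  bin_entropy (density theta)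
  - \sum_i alpha theta i * bin_entropy (prob theta i).
Proof.
have a0 := alpha_ge0 theta; have p01 := prob_itv theta.
have M0 : mmax%:R != 0 :> R by rewrite pnatr_eq0 -lt0n (mmax_gt0 theta).
set rho := density theta.
have rhoC : 1 - rho = \sum_i alpha theta i * (1 - prob theta i).
  by under eq_bigr do rewrite mulrBr mulr1; rewrite sumrB alpha_sum1.
have lnE (x : blockPair q -> R) i : (forall i, 0 <= x i) ->
    alpha theta i * x i * ln (x i / \sum_i alpha theta i * x i)
    = alpha theta i * x i * (ln (x i) - ln (\sum_i alpha theta i * x i)).
  move=> x0; have [->|/eqP ax] := eqVneq (alpha theta i * x i) 0.
    by rewrite !mul0r.
  have ax0 : 0 < alpha theta i * x i.
    by rewrite lt_neqAle eq_sym mulr_ge0// andbT; apply/eqP.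
  have xi0 : 0 < x i.
    rewrite lt_neqAle x0 andbT; apply/eqP => x0'.
    by rewrite -x0' mulr0 ltxx in ax0.
  rewrite ln_div// posrE// (lt_le_trans ax0)// (bigD1 i)//= lerDl.
  by apply: sumr_ge0 => j _; rewrite mulr_ge0.
rewrite /mean_llr edge_counts_expectationE /=.
transitivity (\sum_i (alpha theta i * prob theta i * ln (prob theta i / rho)
   + alpha theta i * (1 - prob theta i) * ln ((1 - prob theta i) / (1 - rho)))).
  transitivity (mmax%:R^-1 * \sum_i ((trials theta i)%:R * prob theta i
      * ln (prob theta i / rho) + (trials theta i)%:R * (1 - prob theta i)
      * ln ((1 - prob theta i) / (1 - rho)))).
    rewrite /llr; under eq_bigr do rewrite mulrCA mulr_sumr.
    rewrite -mulr_sumr exchange_big/=; congr (_ * _); apply: eq_bigr => i _.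
    rewrite (sum_marginal theta i (fun j => j%:R * ln (prob theta i / rho)
      + ((trials theta i)%:R - j%:R) * ln ((1 - prob theta i) / (1 - rho)))).
    transitivity (
      (\sum_(j < mmax.+1) binomial_pmf (trials theta i) (prob theta i) j * j%:R)
      * (ln (prob theta i / rho) - ln ((1 - prob theta i) / (1 - rho)))
      + (\sum_(j < mmax.+1) binomial_pmf (trials theta i) (prob theta i) j)
      * ((trials theta i)%:R * ln ((1 - prob theta i) / (1 - rho)))).
      rewrite !mulr_suml -big_split/=; apply: eq_bigr => j _; ring.
    rewrite sum_binomial_mean sum_binomial1; ring.
  rewrite mulr_sumr; apply: eq_bigr => i _; rewrite trialsE; field; exact: M0.
transitivity (\sum_i (alpha theta i * prob theta i * (ln (prob theta i) - ln rho)
   + alpha theta i * (1 - prob theta i)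
     * (ln (1 - prob theta i) - ln (1 - rho)))).
  apply: eq_bigr => i _; congr (_ + _).
    by rewrite [LHS]lnE// => j; case/andP: (p01 j).
  rewrite rhoC; rewrite [LHS](lnE (fun i => 1 - prob theta i))// => j.
  by rewrite subr_ge0; case/andP: (p01 j).
transitivity (- (\sum_i alpha theta i * prob theta i) * ln rho
  - (\sum_i alpha theta i * (1 - prob theta i)) * ln (1 - rho)
  - \sum_i alpha theta i * bin_entropy (prob theta i)); last first.
  by rewrite -rhoC.
rewrite mulNr !mulr_suml -!sumrN -!big_split/=; apply: eq_bigr => i _.
rewrite /bin_entropy; ring.
Qed.

End ensemble.

Program Definition sbm_transform (R : realType) (q mmax : nat)
    (pi : {perm blockPair q}) (gamma : bool) (theta : sbm_param R q mmax) :
    sbm_param R q mmax :=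
  @SBMParam R q mmax
    (fun i => alpha theta (pi i))
    (fun i => gamma%:R + (1 - 2 * gamma%:R) * prob theta (pi i))
    (mmax_gt0 theta) (fun i => alpha_ge0 theta (pi i)) _
    (fun i => alpha_nat theta (pi i)) _.
Next Obligation.
move=> R q mmax pi gamma theta; rewrite -(alpha_sum1 theta).
by rewrite [RHS](reindex_inj (@perm_inj _ pi)).
Qed.
Next Obligation.
by move=> R q mmax pi [] theta i /=; have := prob_itv theta (pi i); lra.
Qed.

(* Main.v *)
Require Import Defs.
From mathcomp Require Import all_boot all_order all_algebra perm.
From mathcomp Require Import ring.
From mathcomp Require Import all_classical all_reals all_analysis.

Set Implicit Arguments.
Unset Strict Implicit.
Unset Printing Implicit Defensive.

Import Order.TTheory GRing.Theory Num.Theory.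

Local Open Scope ring_scope.

(* The transformation carries the law of the edge counts to itself under the
   bijection that relabels the pairs of blocks by pi and, when gamma = 1,
   exchanges edges with non-edges.  This bijection also carries the log-likelihood
   ratio to itself, because p and 1 - p, rho and 1 - rho are exchanged as well.
   Hence the whole law of the log-likelihood ratio is preserved, in particular
   its mean and the probability that it is negative. *)

(* The identity above t makes this a bijection of all of 'I_m.+1; those values
   have probability 0 under Bin(t, p). *)
Definition ord_flip (m t : nat) (j : 'I_m.+1) : 'I_m.+1 :=
  if (j <= t)%N then inord (t - j) else j.

Lemma val_ord_flip (m t : nat) (j : 'I_m.+1) : (t <= m)%N ->
  ord_flip t j = (if (j <= t)%N then t - j else j)%N :> nat.
Proof.
move=> tm; rewrite /ord_flip; case: ifP => // _.
by rewrite inordK// ltnS (leq_trans (leq_subr _ _)).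
Qed.

Lemma ord_flipK (m t : nat) : (t <= m)%N -> involutive (@ord_flip m t).
Proof.
move=> tm j; apply: val_inj; rewrite /= !val_ord_flip//.
by case: (leqP j t) => jt; [rewrite leq_subr subKn|rewrite leqNgt jt].
Qed.

Lemma binomial_pmf_small (R : realType) (n : nat) (p : R) (k : nat) :
  (n < k)%N -> binomial_pmf n p k = 0.
Proof. by move=> nk; rewrite /binomial_pmf bin_small. Qed.

(** For [j <= n], successes and failures trade places and 'C(n, n - j) = 'C(n, j); for [j > n] both
    sides are 0. *)
Lemma binomial_pmf_flip (R : realType) (m n : nat) (p : R) (j : 'I_m.+1) :
  (n <= m)%N -> binomial_pmf n (1 - p) (ord_flip n j) = binomial_pmf n p j.
Proof.
move=> nm; rewrite val_ord_flip//; case: leqP => jn; last first.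
  by rewrite !binomial_pmf_small.
rewrite /binomial_pmf subKn// bin_sub// mulrC; congr (_ ^+ _ * _ *+ _).
by rewrite /unstable.onem; ring.
Qed.

Section transform.
Context {R : realType} {q mmax : nat}.
Variables (pi : {perm blockPair q}) (gamma : bool) (theta : sbm_param R q mmax).

Let theta' := sbm_transform pi gamma theta.

Definition counts_transform (k : edgeCounts q mmax) : edgeCounts q mmax :=
  [ffun i => if gamma then ord_flip (trials theta (pi i)) (k (pi i))
             else k (pi i)].

Lemma counts_transform_inj : injective counts_transform.
Proof.
move=> k1 k2 /ffunP k12; apply/ffunP => i.
(* Evaluating at the preimage of [i] under [pi] isolates the count [k i]. *)
have := k12 ((pi^-1)%g i); rewrite !ffunE permKV; case: ifP => // _.
by apply: (inv_inj (ord_flipK _)); exact: trials_le.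
Qed.

(** The density is an average with weights summing to 1, so it commutes with affine maps. *)
Lemma density_transform :
  density theta' = gamma%:R + (1 - 2 * gamma%:R) * density theta.
Proof.
transitivity (\sum_i (alpha theta i * gamma%:R
    + (1 - 2 * gamma%:R) * (alpha theta i * prob theta i))).
  rewrite [RHS](reindex_inj (@perm_inj _ pi)); apply: eq_bigr => i _ /=; ring.
by rewrite big_split/= -mulr_suml alpha_sum1 mul1r -mulr_sumr.
Qed.

Lemma edge_counts_pmf_transform (k : edgeCounts q mmax) :
  edge_counts_pmf theta' (counts_transform k) = edge_counts_pmf theta k.
Proof.
rewrite /edge_counts_pmf [RHS](reindex_inj (@perm_inj _ pi)).
apply: eq_bigr => i _; rewrite ffunE.
rewrite (_ : trials theta' i = trials theta (pi i))//.
rewrite /theta' /=; case: gamma => /=.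
  rewrite -[RHS]binomial_pmf_flip ?trials_le//.
  by congr binomial_pmf; ring.
by congr binomial_pmf; ring.
Qed.

Lemma edge_counts_pmf_support (k : edgeCounts q mmax) :
  edge_counts_pmf theta k != 0 -> forall i, (k i <= trials theta i)%N.
Proof.
move=> /prodf_neq0 k0 i; rewrite leqNgt; apply/negP => ki.
by have := k0 i isT; rewrite binomial_pmf_small ?eqxx.
Qed.

(** The bound on [k] matters: above [trials theta i], [ord_flip] is the identity and does not
    exchange edges with non-edges. *)
Lemma llr_transform (k : edgeCounts q mmax) :
  (forall i, k i <= trials theta i)%N ->
  llr theta' (counts_transform k) = llr theta k.
Proof.
move=> kt; rewrite /llr density_transform; congr (_ * _).
rewrite [RHS](reindex_inj (@perm_inj _ pi)); apply: eq_bigr => i _.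
rewrite ffunE (_ : trials theta' i = trials theta (pi i))// /theta' /=.
case: gamma => /=; last by rewrite mulr0 subr0 !add0r !mul1r.
have flip1 (x : R) : 1 + (1 - 2 * 1) * x = 1 - x by ring.
(* Double complements cancel, leaving the edge and non-edge terms swapped. *)
rewrite !flip1 val_ord_flip ?trials_le// kt natrB// !subKr.
by rewrite addrC.
Qed.

Lemma llr_law_transform (f : R -> R) :
  \sum_k edge_counts_pmf theta' k * f (llr theta' k) =
  \sum_k edge_counts_pmf theta k * f (llr theta k).
Proof.
rewrite [LHS](reindex_inj counts_transform_inj); apply: eq_bigr => k _.
rewrite edge_counts_pmf_transform.
(* Counts violating the bound in [llr_transform] have weight 0. *)
have [->|/edge_counts_pmf_support kt] := eqVneq (edge_counts_pmf theta k) 0.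
  by rewrite !mul0r.
by rewrite llr_transform.
Qed.

End transform.

(** Puts [eta] in the form required by [llr_law_transform], with [f] the indicator of the negative
    reals. *)
Lemma etaE (R : realType) (q mmax : nat) (theta : sbm_param R q mmax) :
  eta theta = 1 - \sum_k edge_counts_pmf theta k * (llr theta k < 0)%R%:R.
Proof.
rewrite /eta edge_counts_probE /=; congr (1 - _).
rewrite big_mkcond; apply: eq_bigr => k _.
rewrite (_ : (k \in _) = (llr theta k < 0)); last first.
  by apply/idP/idP => [/set_mem|?]; last exact/mem_set.
by case: ifP => _; rewrite ?mulr1 ?mulr0.
Qed.

Theorem mainTheorem4 (R : realType) (q mmax : nat)
    (pi : {perm blockPair q}) (gamma : bool) (theta : sbm_param R q mmax) :
  mean_llr (sbm_transform pi gamma theta) = mean_llr theta /\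
  eta (sbm_transform pi gamma theta) = eta theta.
Proof.
split.
  by rewrite /mean_llr !edge_counts_expectationE (llr_law_transform _ _ _ id).
by rewrite !etaE (llr_law_transform _ _ _ (fun x => (x < 0)%R%:R)).
Qed.
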